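(* Let $R$ be a ring, and let $a,b,c,d\in R$ satisfy $$(ac)^2=(db)(ac),\quad (db)^2=(ac)(db),\quad b(ac)a=b(db)a,\quad c(ac)d=c(db)d.$$ Then $ac\in R^{D}$ if and only if $bd\in R^{D}$. In this case, $$(bd)^{D}=b\big((ac)^{D}\big)^2d\quad\text{and}\quad i(bd)\leq i(ac)+2.$$
   Context: All rings are associative with an identity. For $a\in R$, $comm(a)=\{x\in R : xa=ax\}$ and $comm^2(a)=\{x\in R : xy=yx \text{ for all } y\in comm(a)\}$. An element $a\in R$ has a Drazin inverse if there exists $b\in R$ such that $b=bab$, $b\in comm^2(a)$ and $a^k=a^{k+1}b$ for some $k\in\mathbb{N}$ (with $\mathbb{N}=\{1,2,3,\dots\}$). Such $b$ is unique if it exists and is denoted $a^{D}$. The smallest such $k$ is the Drazin index of $a$, denoted $i(a)$. $R^{D}$ denotes the set of all Drazin invertible elements of $R$. *)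

(* Defs.v *)
From HB Require Import structures.
From mathcomp Require Import all_boot all_order all_algebra.
From mathcomp Require Import boolp classical_sets.

Set Implicit Arguments.
Unset Strict Implicit.
Unset Printing Implicit Defensive.

Import GRing.Theory.
Local Open Scope ring_scope.

Section Drazin.
Variable R : pzRingType.
Implicit Types a b x y : R.

Definition comm_set a : set R := [set x | x * a = a * x]%classic.

Definition comm2_set a : set R :=
  [set x | forall y, comm_set a y -> x * y = y * x]%classic.

Definition is_drazin_inverse a b : Prop :=
  [/\ b = b * a * b,
      comm2_set a b
    & exists2 k : nat, (0 < k)%N & a ^+ k = a ^+ k.+1 * b].

Definition drazin_invertible : set R :=
  [set a | exists b, is_drazin_inverse a b]%classic.

(* 0 is a junk value when [a] is not Drazin invertible. *)
Definition drazin_inverse a : R :=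
  xget 0 [set b | is_drazin_inverse a b]%classic.

(* The index ranges over positive integers, so it is 1 (not 0) when [a] is a
   unit. *)
Definition is_drazin_index a (k : nat) : Prop :=
  [/\ (0 < k)%N,
      a ^+ k = a ^+ k.+1 * drazin_inverse a
    & forall j : nat, (0 < j)%N ->
        a ^+ j = a ^+ j.+1 * drazin_inverse a -> (k <= j)%N].

(* 0 is a junk value when [a] is not Drazin invertible. *)
Definition drazin_index a : nat :=
  xget 0%N [set k | is_drazin_index a k]%classic.

Lemma is_drazin_inverseP a :
  drazin_invertible a -> is_drazin_inverse a (drazin_inverse a).
Proof. by move=> [b ab]; exact: (xgetPex 0 (ex_intro _ b ab)). Qed.

Lemma is_drazin_indexP a :
  drazin_invertible a -> is_drazin_index a (drazin_index a).
Proof.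
move=> /is_drazin_inverseP[_ _ [k k_gt0 ak]].
pose P j := (0 < j)%N && (a ^+ j == a ^+ j.+1 * drazin_inverse a).
have exP : exists j, P j by exists k; rewrite /P k_gt0 -ak eqxx.
suff : is_drazin_index a (ex_minn exP).
  by move=> h; exact: (xgetPex 0%N (ex_intro _ _ h)).
case: ex_minnP => m /andP[m_gt0 /eqP am] m_min; split=> // j j_gt0 aj.
by apply: m_min; rewrite /P j_gt0 -aj eqxx.
Qed.

Lemma is_drazin_inverse_comm a b : is_drazin_inverse a b -> b * a = a * b.
Proof. by move=> [_ + _]; apply. Qed.

Lemma is_drazin_inverse_mul a b b' :
  is_drazin_inverse a b -> is_drazin_inverse a b' -> a * b' * b = b.
Proof.
move=> ab ab'; have cb := is_drazin_inverse_comm ab.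
have cb' := is_drazin_inverse_comm ab'.
have bE n : b = a ^+ n * b ^+ n.+1.
  elim: n => [|n IHn]; first by rewrite expr0 expr1 mul1r.
  case: ab => bab _ _; rewrite {1}IHn (exprSr a) -mulrA; congr (_ * _).
  by rewrite !exprS !mulrA -cb -bab.
have [_ _ [k _ ak]] := ab'.
have aka : a * b' * a ^+ k = a ^+ k.
  by rewrite -mulrA (commrX k (cb' : GRing.comm b' a)) mulrA -exprS -ak.
by rewrite {1}(bE k) mulrA aka -bE.
Qed.

Lemma is_drazin_inverse_uniq a b b' :
  is_drazin_inverse a b -> is_drazin_inverse a b' -> b = b'.
Proof.
move=> ab ab'; rewrite -(is_drazin_inverse_mul ab ab').
rewrite -[RHS](is_drazin_inverse_mul ab' ab) -!mulrA; congr (_ * _).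
by case: ab => _ b2 _; rewrite b2//; exact: is_drazin_inverse_comm.
Qed.

Lemma drazin_inverseE a b : is_drazin_inverse a b -> drazin_inverse a = b.
Proof.
move=> ab; apply: (@is_drazin_inverse_uniq a); last exact: ab.
by apply: is_drazin_inverseP; exists b.
Qed.

End Drazin.

(* Main.v *)
(* Put p = ac and q = db, so that p^2 = qp and q^2 = pq, and let x be the Drazin
   inverse of p.  Since x is a left multiple of p, q acts on x from the left as p
   does, and c p d = c q d makes q act on d as p does after a left factor p.
   Hence b x^2 d is a Drazin inverse of bd.  The hypotheses are invariant under
   exchanging (a, c) with (d, b), and a = d, c = b is a trivial instance (Cline's
   formula), so the converse is the chain bd -> db -> ca -> ac of instances of
   the direct implication. *)
Require Import Defs.
From HB Require Import structures.
From mathcomp Require Import all_boot all_order all_algebra.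

Set Implicit Arguments.
Unset Strict Implicit.
Unset Printing Implicit Defensive.

Import GRing.Theory.
Local Open Scope ring_scope.

(** Commuting with [a] alone already forces the double commutant condition: the idempotent ab equals
    both a^k b^k and b^k a^k, so whatever commutes with [a] can be moved through it. *)
Lemma comm_is_drazin_inverse (R : pzRingType) (a b : R) (k : nat) :
  b = b * a * b -> b * a = a * b -> (0 < k)%N -> a ^+ k = a ^+ k.+1 * b ->
  is_drazin_inverse a b.
Proof.
move=> bab ba k_gt0 ak; split=> //; last by exists k.
move=> y; rewrite /comm_set /= => ya.
have yX : y * a ^+ k = a ^+ k * y by apply: commrX.
set e := a * b.
have be : b * e = b by rewrite /e mulrA -bab.
have eb : e * b = b by rewrite /e -ba -bab.
have ee : e * e = e by rewrite /e -mulrA be.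
have ea : GRing.comm e a by rewrite /GRing.comm /e -[in LHS]ba -ba mulrA -ba.
have ake : a ^+ k * e = a ^+ k by rewrite /e mulrA -exprSr -ak.
have eak : e * a ^+ k = a ^+ k by rewrite (commrX k ea) ake.
have eX : e = e ^+ k.
  case: k k_gt0 {ak yX ake eak} => // k _.
  by elim: k => // k IHk; rewrite exprS -IHk.
have eE : e = a ^+ k * b ^+ k by rewrite eX exprMn_comm.
have eE' : e = b ^+ k * a ^+ k by rewrite eX /e -ba exprMn_comm.
(* The idempotent e commutes with y because ey and ye both equal eye. *)
have ey : e * y = e * y * e.
  have -> : e * y = b ^+ k * y * a ^+ k by rewrite eE' -!mulrA yX.
  by rewrite -[RHS]mulrA ake.
have ye : y * e = e * y * e.
  rewrite -[RHS]mulrA; have -> : y * e = a ^+ k * y * b ^+ k.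
    by rewrite eE mulrA yX.
  by rewrite !mulrA eak.
(* by = bey = bye = byab = bayb = eyb = yeb = yb. *)
rewrite -[in LHS]be -mulrA ey -ye /e !mulrA -[b * y * a]mulrA ya !mulrA ba.
by rewrite -/e ey -ye -mulrA eb.
Qed.

Section DrazinMulSwap.
Variables (R : pzRingType) (p b d : R).
Hypothesis ppE : p ^+ 2 = (d * b) * p.
Hypothesis qqE : (d * b) ^+ 2 = p * (d * b).
Hypothesis ppdE : p * p * d = p * (d * b) * d.

Lemma exprS_mul_swap n : (b * d) ^+ n.+1 = b * (d * b) ^+ n * d.
Proof.
elim: n => [|n IHn]; first by rewrite expr0 mulr1 expr1.
by rewrite exprS IHn [in RHS]exprS !mulrA.
Qed.

Lemma mul_swap_expr n : (d * b) * p ^+ n.+1 = p ^+ n.+2.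
Proof. by rewrite exprS mulrA -ppE -exprD. Qed.

Lemma expr_swap_mul n : (d * b) ^+ n.+1 = p ^+ n * (d * b).
Proof.
elim: n => [|[|n] IHn]; first by rewrite expr1 mul1r.
  by rewrite qqE expr1.
by rewrite exprS IHn mulrA mul_swap_expr.
Qed.

(** The exponent [k] is arbitrary, so that taking it to be the index of [p] yields the index
    bound. *)
Lemma is_drazin_inverse_mul_swap x k :
  is_drazin_inverse p x -> (0 < k)%N -> p ^+ k = p ^+ k.+1 * x ->
  is_drazin_inverse (b * d) (b * x ^+ 2 * d) /\
  (b * d) ^+ (k + 2) = (b * d) ^+ (k + 2).+1 * (b * x ^+ 2 * d).
Proof.
move=> px k_gt0 pk; have xp := is_drazin_inverse_comm px.
have [xpx _ _] := px.
have px2 : p * x ^+ 2 = x by rewrite expr2 mulrA -xp -xpx.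
have x2p : x ^+ 2 * p = x by rewrite expr2 -mulrA xp mulrA -xpx.
(* Writing x = p x^2 supplies the factor [p] that absorbs each q = db. *)
have qXx n : (d * b) ^+ n * x = p ^+ n * x.
  elim: n => [|n IHn]; first by rewrite !expr0.
  rewrite exprS -mulrA IHn -px2 !(mulrA _ p) -exprSr mulrA mul_swap_expr.
  by rewrite -exprSr.
have qxA z : d * (b * (x * z)) = p * (x * z).
  by have := congr1 ( *%R^~ z) (qXx 1%N); rewrite /= !expr1 -!mulrA.
have ppd : p * (d * (b * d)) = p * (p * d) by rewrite !mulrA ppdE !mulrA.
have xqd : x * (d * (b * d)) = x * (p * d).
  by rewrite -x2p -!mulrA ppd.
have bdy : b * d * (b * x ^+ 2 * d) = b * x * d.
  by rewrite expr2 -!mulrA qxA -[in RHS]px2 expr2 -!mulrA.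
have ybd : b * x ^+ 2 * d * (b * d) = b * x * d.
  by rewrite expr2 -!mulrA xqd -[in RHS]x2p expr2 -!mulrA.
have pow : (b * d) ^+ (k + 2) = (b * d) ^+ (k + 2).+1 * (b * x ^+ 2 * d).
  (* With q = db, the left side is b q^(k+1) d and the right side is b q^(k+2) x d = b p^(k+2) x d =
     b p^(k+1) d. *)
  rewrite exprSr -mulrA bdy addn2 !exprS_mul_swap.
  have -> : b * (d * b) ^+ k.+1 * d * (b * x * d) =
          b * ((d * b) ^+ k.+2 * x) * d.
    by rewrite [in RHS]exprSr !mulrA.
  rewrite qXx [p ^+ _]exprS -(mulrA p) -pk -[p * _]exprS.
  rewrite -!(mulrA b); congr (_ * _).
  (* Positivity of [k] matters: q^(k+1) = p^k q then has a [p] just before q, as [ppd] requires. *)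
  case: k k_gt0 {pk} => // k _.
  by rewrite expr_swap_mul !exprSr -!mulrA ppd.
split=> //; apply: (comm_is_drazin_inverse (k := k + 2)) => //.
- by rewrite ybd expr2 -!mulrA qxA !mulrA -!(mulrA b) -xpx.
- by rewrite bdy ybd.
- by rewrite addn2.
Qed.

Lemma drazin_invertible_mul_swap :
  drazin_invertible p -> drazin_invertible (b * d).
Proof.
move=> [x px]; have [_ _ [k k_gt0 pk]] := px.
by exists (b * x ^+ 2 * d); case: (is_drazin_inverse_mul_swap px k_gt0 pk).
Qed.

End DrazinMulSwap.

Lemma drazin_invertible_mulC (R : pzRingType) (b d : R) :
  drazin_invertible (d * b) -> drazin_invertible (b * d).
Proof. by apply: (@drazin_invertible_mul_swap _ (d * b)); rewrite ?expr2. Qed.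

Theorem theorem2p5 (R : pzRingType) (a b c d : R)
  (h1 : (a * c) ^+ 2 = (d * b) * (a * c))
  (h2 : (d * b) ^+ 2 = (a * c) * (d * b))
  (h3 : b * (a * c) * a = b * (d * b) * a)
  (h4 : c * (a * c) * d = c * (d * b) * d) :
  (drazin_invertible (a * c) <-> drazin_invertible (b * d)) /\
  (drazin_invertible (a * c) ->
     drazin_inverse (b * d) = b * drazin_inverse (a * c) ^+ 2 * d /\
     (drazin_index (b * d) <= drazin_index (a * c) + 2)%N).
Proof.
have h4' : a * c * (a * c) * d = a * c * (d * b) * d.
  by rewrite -!mulrA in h4 *; rewrite h4.
have h3' : d * b * (d * b) * a = d * b * (a * c) * a.
  by rewrite -!mulrA in h3 *; rewrite h3.
split=> [|acD].
  split=> [|bdD]; first exact: drazin_invertible_mul_swap.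
  (* Here db plays the role of [p], which exchanges [h1] and [h2]; the goals run backwards from ac
     through ca and db to bd. *)
  apply: drazin_invertible_mulC; apply: drazin_invertible_mul_swap h2 h1 h3' _.
  exact: drazin_invertible_mulC.
have acx := is_drazin_inverseP acD.
have [k_gt0 ack _] := is_drazin_indexP acD.
have [bdy bdk] := is_drazin_inverse_mul_swap h1 h2 h4' acx k_gt0 ack.
split; first exact: drazin_inverseE.
have [|_ _ bd_min] := @is_drazin_indexP _ (b * d); first by eexists; exact: bdy.
by apply: bd_min; rewrite ?addn2// -addn2 (drazin_inverseE bdy).
Qed.
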